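(* Let $L=kI-A$ be the Laplacian matrix of the skew-lines graph $\Gamma$ on the $2$-dimensional subspaces of $V=\mathbb F_q^n$, where $n\ge4$, $q=p^t$, and $A$ is the adjacency matrix of $\Gamma$. For $0\le i<4t$ the multiplicity of $p^i$ as an elementary divisor of $L$ equals the multiplicity of $p^i$ as an elementary divisor of $A$, and for $i\ge4t$ the multiplicity of $p^i$ as an elementary divisor of $L$ is $0$.
   Context: Let $p$ be a prime, $q=p^t$ with $t\ge1$, $n\ge4$, and $V$ an $n$-dimensional vector space over $\mathbb F_q$. The skew-lines graph $\Gamma$ has as vertices the $2$-dimensional subspaces of $V$, two being adjacent when their intersection is $\{0\}$. It is regular of valency $k=q^4\left[\begin{smallmatrix}n-2\\ 2\end{smallmatrix}\right]_q$, where $\left[\begin{smallmatrix}m\\ j\end{smallmatrix}\right]_q$ is the number of $j$-dimensional subspaces of $\mathbb F_q^m$. The multiplicity of $p^i$ as an elementary divisor of an integer matrix is the number of nonzero diagonal entries of its Smith normal form whose $p$-adic valuation is exactly $i$. *)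

(* Defs.v *)
From HB Require Import structures.
From mathcomp Require Import all_boot all_order all_algebra.

Set Implicit Arguments.
Unset Strict Implicit.
Unset Printing Implicit Defensive.

Import Order.TTheory GRing.Theory Num.Theory.

Local Open Scope ring_scope.

Section FiniteSubspaces.
(* for the subtype structure of [{vspace V}] over square matrices *)
Import VectorInternalTheory.
Variables (F : finFieldType) (V : vectType F).
HB.instance Definition _ := [Countable of {vspace V} by <:].
HB.instance Definition _ := [Finite of {vspace V} by <:].
End FiniteSubspaces.

Definition gauss_binomial (F : finFieldType) (m j : nat) : nat :=
  #|[set U : {vspace 'rV[F]_m} | \dim U == j]|.

Definition line (F : finFieldType) (V : vectType F) : predArgType :=
  {U : {vspace V} | \dim U == 2}.

Definition skew_lines (F : finFieldType) (V : vectType F) : rel (line V) :=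
  fun U W => (val U :&: val W)%VS == 0%VS.

Definition adjacency_mx (T : finType) (e : rel T) : 'M[int]_#|T| :=
  \matrix_(i, j) (e (enum_val i) (enum_val j))%:R.

Definition skew_adjacency (F : finFieldType) (V : vectType F) :
    'M[int]_#|line V| :=
  adjacency_mx (@skew_lines F V).

Definition skew_valency (F : finFieldType) (n : nat) : nat :=
  (#|F| ^ 4 * gauss_binomial F (n - 2) 2)%N.

Definition skew_laplacian (F : finFieldType) (V : vectType F) (n : nat) :
    'M[int]_#|line V| :=
  (skew_valency F n)%:Z%:M - skew_adjacency V.

(* [d] lists the diagonal of a Smith normal form of [M].  No sign is imposed
   on its entries, so [d] is determined only up to signs. *)
Definition smith_diagonal (m n : nat) (M : 'M[int]_(m, n)) (d : seq int) :
    Prop :=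
  [/\ size d = minn m n,
      sorted (fun a b : int => (a %| b)%Z) d
    & exists P : 'M[int]_m, exists Q : 'M[int]_n,
        [/\ P \in unitmx, Q \in unitmx
          & M = P *m (\matrix_(i, j) (d`_i *+ (i == j :> nat))) *m Q]].

Definition ppart_multiplicity (p i : nat) (d : seq int) : nat :=
  count (fun a : int => (a != 0) && (logn p `|a|%N == i)) d.

(* Every integer matrix has such a diagonal, so quantifying over all of them
   is never vacuous. *)
Lemma smith_diagonal_exists (m n : nat) (M : 'M[int]_(m, n)) :
  exists d, smith_diagonal M d.
Proof.
have [P uP [Q uQ [d sd defM]]] := int_Smith_normal_form M.
have nth_d i : (i < minn m n)%N ->
    (mkseq (fun k => d`_k) (minn m n))`_i = d`_i by exact: nth_mkseq.
exists (mkseq (fun k => d`_k) (minn m n)); split.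
- by rewrite size_mkseq.
- apply/(sortedP 0) => i; rewrite size_mkseq => lt_i.
  rewrite !nth_d ?(ltnW lt_i) //.
  have [lt_d | le_d] := ltnP i.+1 (size d); first exact: (sortedP 0 sd).
  by rewrite [d`_i.+1]nth_default ?dvdz0.
- exists P, Q; split=> //; rewrite {1}defM; congr (_ *m _ *m _).
  apply/matrixP=> i j; rewrite !mxE; case: eqP => [eq_ij | _]; last first.
    by rewrite !mulr0n.
  by rewrite nth_d // leq_min ltn_ord [X in (X < n)%N]eq_ij ltn_ord.
Qed.

(* Main.v *)
Require Import Defs.
From mathcomp Require Import all_boot all_order all_algebra.
From mathcomp Require Import all_fingroup all_field.
From mathcomp Require Import ring zify.

Set Implicit Arguments.
Unset Strict Implicit.
Unset Printing Implicit Defensive.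

Import Order.TTheory GRing.Theory Num.Theory.

Local Open Scope ring_scope.

(**
  The valency [k] is a multiple of [q ^ 4 = p ^ (4 t)], so [L] and [- A] agree
  modulo [p ^ (4 t)] and have the same elementary divisors [p ^ i] for
  [i < 4 t].

  Let [B] be the incidence matrix of lines against points of the projective
  space.  Two distinct points lie on exactly one line and two distinct lines
  share at most one point, so [A = q I + J - B B^T] and
  [B^T B = (d - 1) I + J], where [d] is the number of lines on a point.  Hence
  [L (b I - B B^T) = a b I + c J] with [a = k - q] and [b = k - q + d - 1] the
  nonzero eigenvalues of [L], of [p]-adic valuations [t] and [2 t]; together
  with [L J = 0] this bounds the valuations of the nonzero elementary divisors
  of [L] by [3 t].
*)

(** * Smith forms of matrices congruent modulo a power of [p] *)

Lemma dvdz_pfactor_mul (p e : nat) (a b : int) :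
  prime p -> (p%:Z ^+ e %| a * b)%Z -> ~~ (p%:Z ^+ e %| b)%Z ->
  (p %| a)%Z.
Proof.
move=> p_pr dvd_ab; apply: contraR => ndvd_a.
suff cop : coprimez (p%:Z ^+ e) a by rewrite -(Gauss_dvdzr _ cop).
by rewrite coprimezXl // coprimezE prime_coprime.
Qed.

Lemma unitmx_mod_prime (p m : nat) (Y : 'M[int]_m) :
  prime p -> Y \in unitmx ->
  map_mx (intr : int -> 'F_p) Y \in unitmx.
Proof. by move=> p_pr; rewrite !unitmxE det_map_mx; apply: rmorph_unit. Qed.

Lemma intr_Fp_eq0 (p : nat) (a : int) :
  prime p -> (a%:~R == 0 :> 'F_p) = (p %| a)%Z.
Proof. by move=> p_pr; rewrite -(dvdz_pcharf (pchar_Fp p_pr)). Qed.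

(* A nonzero term in the Leibniz expansion of [\det Y] is a permutation
   mapping [S] into [T]. *)
Lemma unitmx_zero_block (K : fieldType) (m : nat) (Y : 'M[K]_m)
    (S T : {set 'I_m}) :
  Y \in unitmx -> (forall i j, i \in S -> j \notin T -> Y i j = 0) ->
  (#|S| <= #|T|)%N.
Proof.
rewrite unitmxE unitfE => detY Y0.
have /existsP[s /forallP Ys] :
    [exists s : 'S_m, [forall i, Y i (s i) != 0]].
  apply: contraR detY => /existsPn Ys; rewrite /determinant big1 // => s _.
  have /forallPn[i] := Ys s; rewrite negbK => /eqP Yi.
  by rewrite (bigD1 i) //= Yi mul0r mulr0.
rewrite -(card_imset S (@perm_inj _ s)).
apply/subset_leq_card/subsetP => _ /imsetP[i Si ->].
by apply: contraR (Ys i) => /Y0->.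
Qed.

(** Where [p ^ e] divides [d i] but not [d' j], the congruence forces [p] to divide [Y i j]. So [Y]
    modulo [p] is an invertible matrix with a zero block, which limits the size of the block. *)
Lemma leq_card_dvdz_diag (p e m : nat) (d d' : 'I_m -> int) (X Y : 'M[int]_m) :
  prime p -> Y \in unitmx ->
  (forall i j, (p%:Z ^+ e %| d i * X i j - Y i j * d' j)%Z) ->
  (#|[set i | (p%:Z ^+ e %| d i)%Z]| <= #|[set j | (p%:Z ^+ e %| d' j)%Z]|)%N.
Proof.
move=> p_pr uY dvdXY.
apply: (unitmx_zero_block (unitmx_mod_prime p_pr uY)) => i j.
rewrite !inE mxE => d_i d'_j; apply/eqP; rewrite intr_Fp_eq0 //.
apply: dvdz_pfactor_mul d'_j => //.
by have := dvdXY i j; rewrite rpredBl => [|]; last exact: dvdz_mulr.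
Qed.

Definition diag_seq_mx (m n : nat) (d : seq int) : 'M[int]_(m, n) :=
  \matrix_(i, j) (d`_i *+ (i == j :> nat)).

Lemma mul_diag_seq_mx (m n : nat) (d : seq int) (X : 'M[int]_(m, n)) i j :
  (diag_seq_mx m m d *m X) i j = d`_i * X i j.
Proof.
rewrite mxE (bigD1 i) //= mxE eqxx big1 ?addr0 // => l ne_li.
by rewrite mxE eq_sym -val_eqE in ne_li *; rewrite (negPf ne_li) mul0r.
Qed.

Lemma mulmx_diag_seq (m n : nat) (d : seq int) (X : 'M[int]_(m, n)) i j :
  (X *m diag_seq_mx n n d) i j = X i j * d`_j.
Proof.
rewrite mxE (bigD1 j) //= mxE eqxx big1 ?addr0 // => l ne_lj.
by rewrite mxE -val_eqE in ne_lj *; rewrite (negPf ne_lj) mulr0.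
Qed.

Lemma count_card_ord (a : pred int) (m : nat) (d : seq int) :
  size d = m -> count a d = #|[set i : 'I_m | a d`_i]|.
Proof.
move=> <-; rewrite -sum1_count (big_nth 0) big_mkord -sum1_card.
by apply: eq_bigl => i; rewrite inE.
Qed.

Lemma dvdz_pfactor_logn (p i : nat) (a : int) :
  prime p -> a != 0 -> (p%:Z ^+ i %| a)%Z = (i <= logn p `|a|)%N.
Proof.
move=> p_pr a_neq0; rewrite dvdzE abszX absz_nat pfactor_dvdn //.
by rewrite lt0n absz_eq0.
Qed.

(** A zero entry is divisible by every power of [p], so it adds one to both counts and cancels.
    Exact multiplicities are thus differences of divisibility counts. *)
Lemma ppart_multiplicityS (p i : nat) (d : seq int) : prime p ->
  (ppart_multiplicity p i d + count (fun a => (p%:Z ^+ i.+1 %| a)%Z) d)%N =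
  count (fun a => (p%:Z ^+ i %| a)%Z) d.
Proof.
move=> p_pr; elim: d => //= a d <-; rewrite /ppart_multiplicity /=.
have [-> | a_neq0] := eqVneq a 0; first by rewrite !dvdz0 /=; lia.
rewrite !dvdz_pfactor_logn //=; lia.
Qed.

Lemma smith_diagonal_opp (m n : nat) (M : 'M[int]_(m, n)) (d : seq int) :
  smith_diagonal M d -> smith_diagonal (- M) d.
Proof.
case=> sz_d sort_d [P [Q [uP uQ ->]]]; split=> //; exists (- P), Q.
by split; rewrite ?mulNmx // -scaleN1r unitmxZ ?rpredN1 ?unitrN1.
Qed.

(** Cancelling [P] on the left and [Q'] on the right turns the hypothesis into [D X = Y D'] modulo
    [p ^ e], where [D] and [D'] are the diagonal matrices and [Y = invmx P *m P'] is invertible. *)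
Lemma leq_count_dvdz_smith (p e m : nat) (M M' Z : 'M[int]_m) (d d' : seq int) :
  prime p -> smith_diagonal M d -> smith_diagonal M' d' ->
  M = M' + p%:Z ^+ e *: Z ->
  (count (fun a => (p%:Z ^+ e %| a)%Z) d
    <= count (fun a => (p%:Z ^+ e %| a)%Z) d')%N.
Proof.
move=> p_pr [sz_d _ [P [Q [uP uQ defM]]]] [sz_d' _ [P' [Q' [uP' uQ' defM']]]].
rewrite {M}defM {M'}defM' -!/(diag_seq_mx m m _) => eqM.
rewrite minnn in sz_d sz_d'.
rewrite (count_card_ord _ sz_d) (count_card_ord _ sz_d').
apply: (@leq_card_dvdz_diag _ _ _ (nth 0 d) (nth 0 d')
  (Q *m invmx Q') (invmx P *m P')) => // [|i j].
  by rewrite unitmx_mul unitmx_inv uP.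
have /(congr1 (fun X : 'M_m => X i j)) :
    diag_seq_mx m m d *m (Q *m invmx Q') - invmx P *m P' *m diag_seq_mx m m d'
      = p%:Z ^+ e *: (invmx P *m Z *m invmx Q').
  have -> : p%:Z ^+ e *: (invmx P *m Z *m invmx Q') =
      invmx P *m (p%:Z ^+ e *: Z) *m invmx Q'.
    by rewrite -scalemxAr -scalemxAl.
  have -> : p%:Z ^+ e *: Z = P *m diag_seq_mx m m d *m Q
      - P' *m diag_seq_mx m m d' *m Q' by rewrite eqM addrC addKr.
  rewrite mulmxBr mulmxBl.
  by rewrite !mulmxA mulVmx // mul1mx mulmxK.
rewrite mxE [X in _ + X]mxE mul_diag_seq_mx mulmx_diag_seq => ->.
by rewrite mxE dvdz_mulr.
Qed.

Lemma ppart_multiplicity_congr (p e m : nat) (M M' Z : 'M[int]_m)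
    (d d' : seq int) (i : nat) :
  prime p -> smith_diagonal M d -> smith_diagonal M' d' ->
  M = M' + p%:Z ^+ e *: Z -> (i < e)%N ->
  ppart_multiplicity p i d = ppart_multiplicity p i d'.
Proof.
move=> p_pr smM smM' defM lt_ie.
suff eq_count k : (k <= e)%N -> count (fun a => (p%:Z ^+ k %| a)%Z) d =
    count (fun a => (p%:Z ^+ k %| a)%Z) d'.
  (* The multiplicity at [i] involves the counts at [i] and [i.+1], both within range since
     [i < e]. *)
  apply: (@addIn (count (fun a => (p%:Z ^+ i.+1 %| a)%Z) d)).
  by rewrite {2}eq_count // !ppart_multiplicityS // eq_count // ltnW.
move=> le_ke; have defMk : M = M' + p%:Z ^+ k *: (p%:Z ^+ (e - k) *: Z).
  by rewrite scalerA -exprD subnKC.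
apply/eqP; rewrite eqn_leq.
rewrite (leq_count_dvdz_smith p_pr smM smM' defMk).
apply: (leq_count_dvdz_smith p_pr smM' smM
  (Z := - (p%:Z ^+ (e - k) *: Z))).
by rewrite defMk scalerN addrK.
Qed.

(** * Bounding the exponents of the nonzero elementary divisors *)

(** Two constant rows are linearly dependent: [b] times row [i] equals [a] times row [j]. *)
Lemma unitmx_const_rows (K : fieldType) (m : nat) (Y : 'M[K]_m)
    (i j : 'I_m) (a b : K) :
  Y \in unitmx -> row i Y = const_mx a -> row j Y = const_mx b -> i = j.
Proof.
move=> uY Yi Yj; apply/eqP; apply: contraT => ne_ij.
have Yinj (u v : 'rV_m) : u *m Y = v *m Y -> u = v.
  by move=> eq_uv; rewrite -(mulmxK uY u) eq_uv mulmxK.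
have /rowP eq_ab : b *: delta_mx 0 i = a *: delta_mx 0 j :> 'rV[K]_m.
  apply: Yinj; rewrite -!scalemxAl -!rowE Yi Yj; apply/rowP=> l.
  by rewrite !mxE mulrC.
have a0 : a = 0.
  by have := eq_ab j; rewrite !mxE !eqxx eq_sym (negPf ne_ij) mulr0 mulr1.
have /matrixP/(_ 0 i) : delta_mx 0 i = 0 :> 'rV[K]_m.
  by apply: Yinj; rewrite -rowE Yi a0 mul0mx; apply/rowP=> l; rewrite !mxE.
by rewrite !mxE !eqxx => /eqP; rewrite oner_eq0.
Qed.

(* If [p ^ e] divides [d`_i], then comparing the [i]-th rows of
   [diag d *m Q *m X = invmx P *m (a%:M + b *: const_mx 1)] shows that the
   [i]-th row of [invmx P] is constant modulo [p]; this happens for at most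
   one [i], and that [i] is taken by the zero entry of [d]. *)
Lemma ppart_multiplicity_eq0 (p e m : nat) (M X : 'M[int]_m) (a b : int)
    (d : seq int) (i : nat) :
  prime p -> smith_diagonal M d -> ~~ (p%:Z ^+ e %| a)%Z ->
  M *m X = a%:M + b *: const_mx 1 -> M *m (const_mx 1 : 'cV_m) = 0 ->
  (e <= i)%N -> ppart_multiplicity p i d = 0%N.
Proof.
move=> p_pr [sz_d _ [P [Q [uP uQ defM]]]] ndvd_a defMX M1 le_ei.
rewrite minnn in sz_d.
have {}defM : M = P *m diag_seq_mx m m d *m Q by [].
have constP k : (p%:Z ^+ e %| d`_k)%Z -> forall (lt_km : (k < m)%N) l l',
    (p %| invmx P (Ordinal lt_km) l - invmx P (Ordinal lt_km) l')%Z.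
  move=> dvd_dk lt_km l l'; set k' := Ordinal lt_km.
  apply: dvdz_pfactor_mul ndvd_a => //.
  have eqPX : diag_seq_mx m m d *m (Q *m X) =
      a *: invmx P + b *: (invmx P *m const_mx 1).
    transitivity (invmx P *m (M *m X)); last first.
      by rewrite defMX mulmxDr mul_mx_scalar scalemxAr.
    by rewrite defM !mulmxA mulVmx // mul1mx.
  have eqPXk l1 : a * invmx P k' l1 =
      d`_k * (Q *m X) k' l1 - b * \sum_h invmx P k' h.
    have := congr1 (fun Y : 'M_m => Y k' l1) eqPX.
    rewrite mul_diag_seq_mx /= => ->; rewrite !mxE.
    rewrite (eq_bigr (invmx P k')) ?addrK // => h _.
    by rewrite !mxE mulr1.
  (* The term in [b] does not depend on the column, so the difference leaves only a multiple of the
     [k]-th entry of [d]. *)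
  rewrite mulrC mulrBr !eqPXk opprB addrA addrNK -mulrBr.
  by rewrite dvdz_mulr.
have uP' := unitmx_mod_prime p_pr (etrans (unitmx_inv P) uP).
have constFp (k : 'I_m) : (p%:Z ^+ e %| d`_k)%Z ->
    {c : 'F_p | row k (map_mx intr (invmx P)) = const_mx c}.
  move=> dvd_dk; exists (invmx P k k)%:~R; apply/rowP=> l; rewrite !mxE.
  apply/eqP; rewrite -subr_eq0 -rmorphB intr_Fp_eq0 //.
  case: k => k lt_km in dvd_dk l *; exact: constP.
apply/eqP; rewrite -leqn0 leqNgt -has_count; apply/hasPn => x /(nthP 0)[k].
rewrite sz_d => lt_km <-; apply/negP=> /andP[dk_neq0 /eqP log_dk].
have dvd_dk : (p%:Z ^+ e %| d`_k)%Z by rewrite dvdz_pfactor_logn // log_dk.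
have [c1 rowk] := constFp (Ordinal lt_km) dvd_dk.
(* [Q] sends the all-one vector to a nonzero vector killed by the diagonal matrix, so the diagonal
   vanishes at some index [l]. *)
have D1 : diag_seq_mx m m d *m (Q *m (const_mx 1 : 'cV_m)) = 0.
  have := congr1 (mulmx (invmx P)) M1.
  by rewrite defM mulmx0 -!mulmxA mulKmx.
have [l Q1l] : exists l, (Q *m (const_mx 1 : 'cV_m)) l 0 != 0.
  apply/existsP; apply: contraT => /existsPn Q1.
  have /(congr1 (mulmx (invmx Q))) : Q *m (const_mx 1 : 'cV_m) = 0.
    apply/matrixP=> h h'; have := Q1 h; rewrite negbK ord1 => /eqP->.
    by rewrite mxE.
  rewrite mulKmx // mulmx0 => /matrixP/(_ (Ordinal lt_km) 0)/eqP.
  by rewrite !mxE.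
have dl0 : d`_l = 0.
  have /matrixP/(_ l 0) := D1; rewrite mul_diag_seq_mx [RHS]mxE.
  by move/eqP; rewrite mulf_eq0 (negPf Q1l) orbF => /eqP.
have [|c2 rowl] := constFp l; first by rewrite dl0 dvdz0.
have /(congr1 val)/= eq_kl := unitmx_const_rows uP' rowk rowl.
by rewrite eq_kl dl0 in dk_neq0.
Qed.

(** * Counting points and lines of the projective space *)

Definition point (F : finFieldType) (V : vectType F) : predArgType :=
  {P : {vspace V} | \dim P == 1}.

Section SkewLines.

Variables (F : finFieldType) (V : vectType F).
Local Notation q := #|F|.
Implicit Types (U W : line V) (P R : point V).

Lemma dim_point P : \dim (val P) = 1%N.
Proof. exact/eqP/(valP P). Qed.

Lemma dim_line U : \dim (val U) = 2.
Proof. exact/eqP/(valP U). Qed.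

Lemma card_field_gt1 : (1 < q)%N.
Proof. exact: finNzRing_gt1. Qed.

(* The finite type structure on vectors lives on the alias [finvect_type V]. *)
Definition vec (v : finvect_type V) : V := v.

Lemma card_vectors_sub (W : {vspace V}) :
  #|[pred v | vec v \in W]| = (q ^ \dim W)%N.
Proof.
rewrite /vec; case: V W => T cT W.
exact: (@card_vspace F (finvect_type (Vector.Pack cT)) cT W).
Qed.

Lemma card_nonzero_vectors (W : {vspace V}) :
  #|[pred v | (vec v \in W) && (vec v != 0)]|.+1 = (q ^ \dim W)%N.
Proof.
have [z z0] : {z | vec z = 0} by exists (0 : V).
rewrite -card_vectors_sub [RHS](cardD1 z) inE z0 mem0v add1n; congr _.+1.
by apply: eq_card => v; rewrite !inE andbC -z0.
Qed.

(** Each nonzero vector of [W] spans exactly one point, and each point carries [q - 1] nonzero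
    vectors. *)
Lemma card_points_sub (W : {vspace V}) :
  (q.-1 * #|[set P : point V | (val P <= W)%VS]|).+1 = (q ^ \dim W)%N.
Proof.
rewrite -card_nonzero_vectors; congr _.+1.
transitivity (\sum_(P : point V | (val P <= W)%VS)
    \sum_(v | [&& vec v \in W, vec v != 0%R & vec v \in val P]) 1)%N.
  rewrite (eq_bigr (fun=> q.-1)) => [|P /subvP sPW].
    rewrite sum_nat_const mulnC; congr (_ * _)%N.
    by apply: eq_card => P; rewrite inE.
  have := card_nonzero_vectors (val P); rewrite dim_point expn1 => <- /=.
  rewrite -sum1_card; apply: eq_bigl => v; rewrite !inE.
  by have [/sPW-> | _] := boolP (vec v \in val P); rewrite ?andbT ?andbF.
rewrite -sum1_card.
rewrite (exchange_big_dep (fun v => (vec v \in W) && (vec v != 0))) /=;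
  last by move=> P v _ /and3P[-> ->].
apply: eq_bigr => v /andP[Wv v_neq0].
have dim_v : \dim <[vec v]>%VS == 1 by rewrite dim_vline v_neq0.
rewrite (big_pred1 (Sub <[vec v]>%VS dim_v : point V)) // => P /=.
rewrite Wv v_neq0 /= -val_eqE /= [RHS]eq_sym eqEdim dim_point (eqP dim_v) leqnn.
rewrite andbT -memvE andbC; have [vP | //] := boolP (vec v \in val P).
suff -> : val P = <[vec v]>%VS by rewrite -memvE.
by apply/esym/eqP; rewrite eqEdim dim_point (eqP dim_v) -memvE vP.
Qed.

Lemma card_points_line U :
  #|[set P : point V | (val P <= val U)%VS]| = q.+1.
Proof.
have q_gt1 := card_field_gt1.
have := card_points_sub (val U); rewrite dim_line; nia.
Qed.

(** The number of common points is [q + 1], 1 or 0 for equal, meeting or skew lines. This is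
    [A = q I + J - B B^T] entry by entry, arranged without subtraction. *)
Lemma card_points_meet U W :
  (#|[set P : point V | (val P <= val U)%VS && (val P <= val W)%VS]|
     + skew_lines U W = q * (U == W) + 1)%N.
Proof.
have q_gt1 := card_field_gt1.
have -> : [set P : point V | (val P <= val U)%VS && (val P <= val W)%VS]
    = [set P : point V | (val P <= val U :&: val W)%VS].
  by apply/setP=> P; rewrite !inE subv_cap.
have [-> | ne_UW] := eqVneq U W.
  by rewrite /skew_lines capvv card_points_line -dimv_eq0 dim_line; lia.
have le_cap1 : (\dim (val U :&: val W) <= 1)%N.
  rewrite -ltnS -[X in (_ < X)%N](dim_line U) ltn_neqAle dimvS ?capvSl // andbT.
  rewrite (dimv_leqif_eq (capvSl _ _)).
  apply: contra ne_UW => /eqP eqU; rewrite -val_eqE eqEdim !dim_line andbT.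
  by rewrite -eqU capvSr.
have := card_points_sub (val U :&: val W); rewrite /skew_lines -dimv_eq0.
by case: (\dim _) le_cap1 => [|[|//]] _; rewrite ?expn0 ?expn1; nia.
Qed.

Lemma card_lines_two_points P R : P != R ->
  #|[set U : line V | (val P <= val U)%VS && (val R <= val U)%VS]| = 1%N.
Proof.
move=> ne_PR; have dimPR : \dim (val P + val R)%VS == 2.
  rewrite dimv_disjoint_sum ?dim_point // ; apply/eqP.
  rewrite -dimv_eq0 -leqn0 -ltnS -[X in (_ < X)%N](dim_point P).
  rewrite ltn_neqAle dimvS ?capvSl // andbT.
  rewrite (dimv_leqif_eq (capvSl _ _)).
  apply: contra ne_PR => /eqP eqP'; rewrite -val_eqE eqEdim !dim_point andbT.
  by rewrite -eqP' capvSr.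
apply/eqP/cards1P; exists (Sub (val P + val R)%VS dimPR : line V).
apply/setP=> U; rewrite !inE -subv_add eq_sym -val_eqE /= eqEdim.
by rewrite dim_line (eqP dimPR) andbT.
Qed.

Lemma card_points_line_others P U : (val P <= val U)%VS ->
  #|[set R : point V | (R != P) && (val R <= val U)%VS]| = q.
Proof.
move=> sPU; have := card_points_line U.
rewrite (cardsD1 P) inE sPU add1n => /succn_inj <-.
by apply: eq_card => R; rewrite !inE.
Qed.

(** Double count of the pairs of a line on [P] and a further point [R] of it: [R] determines the
    line. In particular the number of lines on [P] is the same for every [P]. *)
Lemma card_lines_point P :
  (#|[set U : line V | (val P <= val U)%VS]| * q)%N = #|point V|.-1.
Proof.
transitivity (\sum_(U : line V | (val P <= val U)%VS)
    \sum_(R | (R != P) && (val R <= val U)%VS) 1)%N.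
  rewrite -sum_nat_const; apply: eq_big => U; first by rewrite inE.
  rewrite inE => sPU; rewrite -(card_points_line_others sPU) -sum1_card.
  by apply: eq_bigl => R; rewrite inE.
rewrite (exchange_big_dep (fun R => R != P)) /=; last by move=> U R _ /andP[].
have -> : #|point V|.-1 = #|[pred R | R != P]| by rewrite (cardC1 P).
rewrite -sum1_card; apply: eq_bigr => R ne_RP.
rewrite ne_RP -[RHS](@card_lines_two_points P R) 1?eq_sym // -sum1_card.
by apply: eq_bigl => U; rewrite !inE.
Qed.

(** Double count of incident point-line pairs, times [q] so that the count of lines on a point
    applies. *)
Lemma card_lines :
  (#|line V| * (q * q.+1))%N = (#|point V| * #|point V|.-1)%N.
Proof.
rewrite (mulnC q) mulnA; transitivity
    ((\sum_(P : point V) #|[set U : line V | (val P <= val U)%VS]|) * q)%N.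
  congr (_ * _)%N; transitivity
      (\sum_(U : line V) \sum_(P : point V | (val P <= val U)%VS) 1)%N.
    rewrite -sum_nat_const; apply: eq_bigr => U _.
    rewrite -(card_points_line U) -sum1_card.
    by apply: eq_bigl => P; rewrite inE.
  rewrite (exchange_big_dep predT) //=; apply: eq_bigr => P _.
  by rewrite -sum1_card; apply: eq_bigl => U; rewrite inE.
rewrite big_distrl /= (eq_bigr (fun=> #|point V|.-1)) ?sum_nat_const // => P _.
exact: card_lines_point.
Qed.

Lemma card_points : (q.-1 * #|point V|).+1 = (q ^ \dim {:V})%N.
Proof.
rewrite -card_points_sub; congr (_ * _).+1.
by apply: eq_card => P; rewrite !inE subvf.
Qed.

End SkewLines.

Lemma card_line_gauss_binomial (F : finFieldType) (m : nat) :
  gauss_binomial F m 2 = #|line 'rV[F]_m|.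
Proof.
by rewrite card_sig; apply: eq_card => U; rewrite !inE.
Qed.

(** * Matrix identities from the point-line incidence matrix *)

Section Incidence.

Variables (F : finFieldType) (V : vectType F).
Local Notation q := #|F|.
Local Notation N := #|line V|.
Local Notation v := #|point V|.

Definition incidence_mx : 'M[int]_(N, v) :=
  \matrix_(i, j) (val (enum_val j) <= val (enum_val i))%VS%:R.
Local Notation B := incidence_mx.
Local Notation J := (const_mx 1 : 'M[int]_N).

Lemma sum_nat_pred (T : finType) (P : pred T) :
  \sum_x (P x)%:R = #|[set x | P x]|%:R :> int.
Proof.
rewrite -sum1_card natr_sum [RHS]big_mkcond.
by apply: eq_bigr => x _; rewrite inE; case: (P x).
Qed.

Lemma sum_enum_val (T : finType) (f : T -> int) :
  \sum_(i < #|T|) f (enum_val i) = \sum_x f x.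
Proof. by rewrite [RHS]big_enum_val. Qed.

Lemma skew_adjacencyE :
  skew_adjacency V = q%:Z%:M + J - B *m B^T.
Proof.
apply/matrixP=> i j; rewrite !mxE.
set U := enum_val i; set W := enum_val j.
rewrite (_ : \sum_k _ = #|[set P : point V |
    (val P <= val U)%VS && (val P <= val W)%VS]|%:R); last first.
  rewrite -sum_nat_pred -[RHS]sum_enum_val; apply: eq_bigr => k _.
  by rewrite !mxE -natrM mulnb.
have := card_points_meet U W; rewrite (inj_eq enum_val_inj) => eqUW.
have -> : q%:Z *+ (i == j) = (q * (i == j))%:Z.
  by case: (i == j); rewrite ?muln1 ?muln0.
by rewrite !natz -(PoszD _ 1) -eqUW PoszD addrAC subrr add0r.
Qed.

Variable d : int.
Hypothesis card_lines_pointE : forall P : point V,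
  #|[set U : line V | (val P <= val U)%VS]|%:Z = d.

Lemma trmx_incidence_mul : B^T *m B = (d - 1)%:M + const_mx 1.
Proof.
apply/matrixP=> i j; rewrite !mxE.
set P := enum_val i; set R := enum_val j.
rewrite (_ : \sum_k _ = #|[set U : line V |
    (val P <= val U)%VS && (val R <= val U)%VS]|%:R); last first.
  rewrite -sum_nat_pred -[RHS]sum_enum_val; apply: eq_bigr => k _.
  by rewrite !mxE -natrM mulnb.
have [eq_ij | ne_ij] := eqVneq i j.
  rewrite mulr1n addrNK -(card_lines_pointE P) natz; congr Posz.
  by apply: eq_card => U; rewrite !inE /R -eq_ij andbb.
by rewrite card_lines_two_points ?(inj_eq enum_val_inj) // mulr0n add0r.
Qed.

Lemma incidence_mul_const n : B *m const_mx 1 = const_mx q.+1%:Z :> 'M_(N, n).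
Proof.
apply/matrixP=> i j; rewrite !mxE -(card_points_line (enum_val i)).
rewrite -[RHS]natz -sum_nat_pred -[RHS]sum_enum_val; apply: eq_bigr => k _.
by rewrite !mxE mulr1.
Qed.

Lemma trmx_incidence_mul_const n : B^T *m const_mx 1 = const_mx d :> 'M_(v, n).
Proof.
apply/matrixP=> i j; rewrite !mxE -(card_lines_pointE (enum_val i)).
rewrite -[RHS]natz -sum_nat_pred -[RHS]sum_enum_val; apply: eq_bigr => k _.
by rewrite !mxE mulr1.
Qed.

Lemma const_mul_trmx_incidence n :
  const_mx 1 *m B^T = const_mx q.+1%:Z :> 'M_(n, N).
Proof.
by apply: trmx_inj; rewrite trmx_mul trmxK !trmx_const incidence_mul_const.
Qed.

Lemma const_mul_incidence n : const_mx 1 *m B = const_mx d :> 'M_(n, v).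
Proof.
by apply: trmx_inj; rewrite trmx_mul !trmx_const trmx_incidence_mul_const.
Qed.

Lemma const_mx_scale m n (a : int) : const_mx a = a *: const_mx 1 :> 'M_(m, n).
Proof. by apply/matrixP=> i j; rewrite !mxE mulr1. Qed.

Lemma collinearity_sqr :
  (B *m B^T) *m (B *m B^T) = (d - 1) *: (B *m B^T) + (q.+1%:Z ^+ 2) *: J.
Proof.
rewrite -mulmxA (mulmxA B^T) trmx_incidence_mul mulmxDl mulmxDr mul_scalar_mx.
rewrite -scalemxAr const_mul_trmx_incidence const_mx_scale -scalemxAr.
by rewrite incidence_mul_const const_mx_scale scalerA expr2.
Qed.

(** With [C = B B^T], the left factor is [a I + C] up to [J], and [C^2 = (d - 1) C] up to [J]. The
    choice [b = a + d - 1] makes the terms in [C] of [(a I + C) (b I - C)] cancel. *)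
Lemma skew_laplacian_mul (k : int) :
  let a := k - q%:Z in let b := a + d - 1 in
  (k%:M - skew_adjacency V) *m (b%:M - B *m B^T)
    = (a * b)%:M + (q.+1%:Z * d - q.+1%:Z ^+ 2 - b) *: J.
Proof.
move=> a b; rewrite skew_adjacencyE.
have JC : J *m (B *m B^T) = (q.+1%:Z * d) *: J.
  rewrite mulmxA const_mul_incidence const_mx_scale -scalemxAl.
  by rewrite const_mul_trmx_incidence const_mx_scale scalerA mulrC.
have C2 := collinearity_sqr; move: (B *m B^T) JC C2 => C JC C2.
have -> : k%:M - (q%:Z%:M + J - C) = a%:M - J + C.
  apply/matrixP=> i j; rewrite !mxE /a.
  by case: (i == j); rewrite ?mulr1n ?mulr0n; ring.
rewrite mulmxBr !mulmxDl !mulNmx C2 JC !mul_mx_scalar !mul_scalar_mx.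
apply/matrixP=> i j; rewrite !mxE /b.
by case: (i == j); rewrite ?mulr1n ?mulr0n; ring.
Qed.

(** The row sums of [A] are [q + N - (q + 1) d]; the hypothesis says that [k] is this number. *)
Lemma skew_laplacian_mul_const (k : int) :
  k - q%:Z - N%:Z + q.+1%:Z * d = 0 ->
  (k%:M - skew_adjacency V) *m (const_mx 1 : 'cV_N) = 0.
Proof.
move=> regular_k.
have J1 : J *m (const_mx 1 : 'cV_N) = const_mx N%:Z.
  apply/matrixP=> i j; rewrite !mxE.
  rewrite (eq_bigr (fun=> 1)) => [|l _]; last by rewrite !mxE mulr1.
  by rewrite sumr_const card_ord natz.
rewrite skew_adjacencyE mulmxBl mulmxBl mulmxDl !mul_scalar_mx J1 -mulmxA.
rewrite trmx_incidence_mul_const (const_mx_scale _ _ d) -scalemxAr.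
rewrite incidence_mul_const.
apply/matrixP=> i j; rewrite !mxE -[RHS]regular_k; ring.
Qed.

End Incidence.

(** * Arithmetic of the valency and the eigenvalues, and the conclusion *)

(* [N], [v] and [d] stand for the numbers of lines, of points and of lines on
   a point in dimension [n], [N'] and [v'] for the numbers of lines and of
   points in dimension [n - 2], and [x] for [q ^+ (n - 2)]. *)
Lemma skew_valency_regular (q x N v d N' v' : int) :
  1 < q -> (q - 1) * v + 1 = q ^+ 2 * x -> d * q = v - 1 ->
  N * (q * (q + 1)) = v * (v - 1) -> (q - 1) * v' + 1 = x ->
  N' * (q * (q + 1)) = v' * (v' - 1) ->
  q ^+ 4 * N' - q - N + (q + 1) * d = 0.
Proof.
move=> q_gt1 vE dE NE v'E N'E.
have q1_neq0 : q - 1 != 0 by rewrite subr_eq0 gt_eqF.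
have q_neq0 : q != 0 by rewrite gt_eqF // (lt_trans _ q_gt1).
have qS_neq0 : q + 1 != 0 by rewrite gt_eqF // addr_gt0 // (lt_trans _ q_gt1).
(* This factor clears the denominators of [N], [N'], [d], [v] and [v'], leaving a polynomial
   identity in [q] and [x]. *)
have c_neq0 : (q + 1) * q * (q - 1) ^+ 2 != 0.
  by rewrite !mulf_neq0 ?expf_neq0.
apply/eqP; rewrite -(mulrI_eq0 _ (lregP c_neq0)).
have -> : (q + 1) * q * (q - 1) ^+ 2 * (q ^+ 4 * N' - q - N + (q + 1) * d)
  = q ^+ 4 * (q - 1) ^+ 2 * (N' * (q * (q + 1)))
    - q ^+ 2 * (q + 1) * (q - 1) ^+ 2
    - (q - 1) ^+ 2 * (N * (q * (q + 1)))
    + (q + 1) ^+ 2 * (q - 1) ^+ 2 * (d * q) by ring.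
rewrite N'E NE dE.
have {}vE : (q - 1) * v = q ^+ 2 * x - 1 by rewrite -vE addrK.
have {}v'E : (q - 1) * v' = x - 1 by rewrite -v'E addrK.
have -> : q ^+ 4 * (q - 1) ^+ 2 * (v' * (v' - 1))
    - q ^+ 2 * (q + 1) * (q - 1) ^+ 2
    - (q - 1) ^+ 2 * (v * (v - 1)) + (q + 1) ^+ 2 * (q - 1) ^+ 2 * (v - 1)
  = q ^+ 4 * (((q - 1) * v') * ((q - 1) * v' - (q - 1)))
    - q ^+ 2 * (q + 1) * (q - 1) ^+ 2
    - ((q - 1) * v) * ((q - 1) * v - (q - 1))
    + (q + 1) ^+ 2 * (q - 1) * ((q - 1) * v - (q - 1)) by ring.
by rewrite vE v'E; apply/eqP; ring.
Qed.

Lemma ndvd_eigenvalue_product (p t m : nat) (q N' d v : int) :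
  prime p -> (0 < t)%N -> q = p%:Z ^+ t ->
  (q - 1) * v + 1 = q ^+ (m + 4) -> d * q = v - 1 ->
  ~~ (p%:Z ^+ (4 * t) %|
      (q ^+ 4 * N' - q) * (q ^+ 4 * N' - q + d - 1))%Z.
Proof.
move=> p_pr t_gt0 qE vE dE.
have p_gt1 : 1 < p%:Z by rewrite ltz_nat prime_gt1.
have q_gt1 : 1 < q by rewrite qE exprn_egt1 // -lt0n.
have q_neq0 : q != 0 by rewrite gt_eqF // (lt_trans _ q_gt1).
have q1_neq0 : q - 1 != 0 by rewrite subr_eq0 gt_eqF.
have p_q : (p %| q)%Z by rewrite qE -(prednK t_gt0) exprS dvdz_mulr.
(* [b] is the number of points in dimension [n - 3 = m.+1], so [b = 1] modulo
   [p], and the two factors have [q]-parts [q] and [q ^+ 2]. *)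
pose b := \sum_(i < m.+1) q ^+ i.
have dB : d - 1 - q = q ^+ 2 * b.
  apply: (mulfI q1_neq0); apply: (mulfI q_neq0).
  have -> : q * ((q - 1) * (q ^+ 2 * b)) = q ^+ 3 * (q ^+ m.+1 - 1).
    by rewrite subrX1 -/b; ring.
  have -> : q * ((q - 1) * (d - 1 - q)) =
      (q - 1) * (d * q) - (q - 1) * q * (1 + q) by ring.
  have -> : q ^+ 3 * (q ^+ m.+1 - 1) = q ^+ (m + 4) - q ^+ 3.
    by rewrite mulrBr -exprD addnC addSnnS mulr1.
  by rewrite dE -vE; ring.
have -> : (q ^+ 4 * N' - q) * (q ^+ 4 * N' - q + d - 1) =
    q ^+ 3 * ((q ^+ 3 * N' - 1) * (q ^+ 2 * N' + b)).
  have -> : q ^+ 4 * N' - q + d - 1 = q ^+ 4 * N' + (d - 1 - q) by ring.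
  by rewrite dB; ring.
have -> : p%:Z ^+ (4 * t) = q ^+ 3 * q by rewrite mulnC exprM -qE -exprSr.
rewrite dvdz_mul2l ?expf_neq0 //; apply: contraTN (prime_gt1 p_pr) => q_dvd.
have [c bE] : exists c, b = 1 + q * c.
  exists (\sum_(i < m) q ^+ i); rewrite /b big_ord_recl expr0 mulr_sumr.
  by congr (_ + _); apply: eq_bigr => i _; rewrite -exprS.
(* After removal of [q ^ 3] the cofactor is [-1] modulo [q], hence modulo [p]. *)
have := dvdz_trans p_q q_dvd.
have -> : (q ^+ 3 * N' - 1) * (q ^+ 2 * N' + b) =
    q * (q ^+ 2 * N' * (q ^+ 2 * N' + b) - q * N' - c) - 1 by rewrite bE; ring.
rewrite rpredBl => [|]; last exact: dvdz_mulr.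
by rewrite -[_ \in _]/(p %| 1)%Z dvdz1 => /eqP /= ->.
Qed.

Lemma PoszX (m n : nat) : (m ^ n)%N%:Z = m%:Z ^+ n.
Proof. by rewrite -!natz natrX. Qed.

Lemma card_points_int (F : finFieldType) (V : vectType F) :
  (#|F|%:Z - 1) * #|point V|%:Z + 1 = #|F|%:Z ^+ \dim {:V}.
Proof.
have q_gt0 := ltnW (card_field_gt1 F).
by rewrite -predn_int // -PoszM -PoszX -card_points -addn1 PoszD.
Qed.

Lemma card_lines_int (F : finFieldType) (V : vectType F) :
  #|line V|%:Z * (#|F|%:Z * (#|F|%:Z + 1))
    = #|point V|%:Z * (#|point V|%:Z - 1).
Proof.
have -> : #|F|%:Z + 1 = #|F|.+1%:Z by rewrite -addn1 PoszD.
rewrite -!PoszM card_lines; case: #|point V| => // v.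
by rewrite PoszM -predn_int.
Qed.

Theorem mainTheorem2 (p t n : nat) (F : finFieldType) (V : vectType F)
    (p_prime : prime p) (t_ge1 : (1 <= t)%N) (cardF : #|F| = (p ^ t)%N)
    (n_ge4 : (4 <= n)%N) (dimV : \dim {:V} = n)
    (dA dL : seq int)
    (smithA : smith_diagonal (skew_adjacency V) dA)
    (smithL : smith_diagonal (skew_laplacian V n) dL) :
  (forall i : nat, (i < 4 * t)%N ->
     ppart_multiplicity p i dL = ppart_multiplicity p i dA) /\
  (forall i : nat, (4 * t <= i)%N -> ppart_multiplicity p i dL = 0%N).
Proof.
have qE : #|F|%:Z = p%:Z ^+ t by rewrite cardF PoszX.
have q_gt1 := card_field_gt1 F.
pose N' := #|line 'rV[F]_(n - 2)|.
have kE : (skew_valency F n)%:Z = #|F|%:Z ^+ 4 * N'%:Z.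
  by rewrite /skew_valency card_line_gauss_binomial PoszM PoszX.
split=> i.
  apply: (ppart_multiplicity_congr p_prime smithL (smith_diagonal_opp smithA)
    (Z := N'%:Z%:M)).
  by rewrite scale_scalar_mx mulnC exprM -qE -kE addrC.
(* A point is needed to define [d], and to read the natural predecessor of the number of points as
   an integer difference. *)
have v_gt0 : (0 < #|point V|)%N.
  rewrite lt0n; apply: contraTneq n_ge4 => v0.
  have := card_points V; rewrite v0 muln0 dimV -(expn0 #|F|) => /eqP.
  by rewrite eqn_exp2l // => /eqP <-.
have /card_gt0P[P0 _] := v_gt0.
pose d := #|[set U : line V | (val P0 <= val U)%VS]|.
have dE : d%:Z * #|F|%:Z = #|point V|%:Z - 1.
  by rewrite -PoszM card_lines_point predn_int.
have dP (P : point V) : #|[set U : line V | (val P <= val U)%VS]|%:Z = d%:Z.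
  congr Posz; apply/eqP; rewrite -(@eqn_pmul2r #|F|) ?(ltnW q_gt1) //.
  by rewrite /d !card_lines_point.
apply: (ppart_multiplicity_eq0 p_prime smithL
  (ndvd_eigenvalue_product N'%:Z (m := n - 4) p_prime t_ge1 qE _ dE)).
- by rewrite card_points_int dimV subnK.
- by rewrite /skew_laplacian kE; exact: (skew_laplacian_mul dP).
- rewrite /skew_laplacian kE; apply: (skew_laplacian_mul_const dP).
  have -> : #|F|.+1%:Z = #|F|%:Z + 1 by rewrite -addn1 PoszD.
  apply: (skew_valency_regular (x := #|F|%:Z ^+ (n - 2))
    (v := #|point V|%:Z) (v' := #|point 'rV[F]_(n - 2)|%:Z)) => //.
  + by rewrite card_points_int dimV -exprD subnKC // (leq_trans _ n_ge4).
  + exact: card_lines_int.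
  + by rewrite card_points_int dimvf dim_matrix; congr (_ ^+ _); exact: mul1n.
  + exact: card_lines_int.
Qed.
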